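(* Let $\mathcal A=(\bar\lambda,\bar{\mathbf J},\bar G,\bar H,\bar\pi,\bar\sigma)$ be an explicit $(\bar\lambda,\bar{\mathbf J})$-system with $\lambda=\sum_{n<\omega}\lambda_n$, and assume $\lambda$ is a strong limit cardinal with $\lambda>\operatorname{cf}(\lambda)=\aleph_0$ and $\operatorname{nu}(\mathcal A)\ge\lambda$. Then $\operatorname{nu}(\mathcal A)=2^\lambda$ and the supremum defining $\operatorname{nu}(\mathcal A)$ is attained.
   Context: A $(\lambda,\mathbf I)$-system consists of: a cardinal $\lambda$ which is $\aleph_0$ or of cofinality $\aleph_0$; an inverse system of groups $\langle G_m,\pi_{m,n}:m\le n<\omega\rangle$ with $|G_n|\le\lambda$ and $G_0$ trivial, with inverse limit $G_\omega$ and projections $\pi_{n,\omega}$; an index set $\mathbf I$ with $|\mathbf I|\le\lambda$; for each $t\in\mathbf I$ an inverse system of groups $\langle H^t_m,\pi^t_{m,n}:m\le n<\omega\rangle$ with $|H^t_m|\le\lambda$ and $H^t_0$ trivial, with inverse limit $H^t_\omega$; and homomorphisms $\sigma^t_n:H^t_n\to G_n$ with $\pi_{m,n}\circ\sigma^t_n=\sigma^t_m\circ\pi^t_{m,n}$ for $m\le n<\omega$, inducing $\sigma^t_\omega:H^t_\omega\to G_\omega$. For $t\in\mathbf I$, $\mathcal E_t$ is the equivalence relation on $G_\omega$: $f\,\mathcal E_t\,g$ iff $fg^{-1}\in\operatorname{Rang}(\sigma^t_\omega)$. $\operatorname{nu}$ of the system is the supremum of the cardinals $\mu$ such that for each $n<\omega$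 there is a sequence $\langle f_i:i<\mu\rangle$ of elements of $G_\omega$ such that (if $\mu\le\lambda$) $\pi_{n,\omega}(f_i)=\pi_{n,\omega}(f_0)$ for all $i<\mu$, and $\neg f_i\,\mathcal E_t\,f_j$ for all $i<j<\mu$, $t\in\mathbf I$. An explicit $(\bar\lambda,\bar{\mathbf J})$-system is $(\bar\lambda,\bar{\mathbf J},\bar G,\bar H,\bar\pi,\bar\sigma)$ where $\bar\lambda=\langle\lambda_n:n<\omega\rangle$ is strictly increasing, $\bar{\mathbf J}=\langle\mathbf J_n:n<\omega\rangle$ is $\subseteq$-increasing, and with $\lambda=\sum_n\lambda_n$, $\mathbf I=\bigcup_n\mathbf J_n$ the data $(\lambda,\mathbf I,\bar G,\bar H,\bar\pi,\bar\sigma)$ form a $(\lambda,\mathbf I)$-system, with moreover $|\mathbf J_n|\le\lambda_n$, $|G_n|\le\lambda_n$, $|H^t_n|<\lambda$ and $|H^t_n|\le|H^t_{n+1}|$; its $\operatorname{nu}$ is that of this $(\lambda,\mathbf I)$-system. *)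

(* Defs.v *)
From HB Require Import structures.
From mathcomp Require Import all_boot.
From mathcomp Require Import boolp classical_sets functions cardinality.
From mathcomp Require Import wochoice.

Set Implicit Arguments.
Unset Strict Implicit.
Unset Printing Implicit Defensive.

Local Open Scope classical_set_scope.
Local Open Scope card_scope.
Local Open Scope group_scope.

(* As in [cardinality], cardinals are handled relationally: a cardinal is
represented by a type of that size, and equality of cardinals is equipotence.
Naming the universe once makes every cardinal below range over the same
universe, which is closed under power set. *)
Definition cardinal := Type.

Definition card_lt T U (A : set T) (B : set U) : Prop :=
  A #<= B /\ ~ (B #<= A).
Notation "A '#<' B" := (card_lt A B) (at level 79) : card_scope.

Definition cardinal_pow2 (L : cardinal) : cardinal := set L.

Definition cardinal_sum (L : nat -> cardinal) : cardinal := {n : nat & L n}.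

Definition strong_limit (L : cardinal) : Prop :=
  forall K : cardinal, [set: K] #< [set: L] ->
    [set: cardinal_pow2 K] #< [set: L].

(* [R] is a (reflexive) well-order of [L] whose order type is the initial
   ordinal of cardinality [L]. *)
Definition initial_order (L : cardinal) (R : rel L) : Prop :=
  well_order R /\ forall x, [set y | R y x /\ y <> x] #< [set: L].

Definition cofinal_in (L : cardinal) (R : rel L) (X : set L) : Prop :=
  forall x, exists2 y, X y & R x y.

(* cf(L) = K; the initial order on [L] is unique up to isomorphism. *)
Definition has_cofinality (L K : cardinal) : Prop :=
  exists R : rel L, [/\ initial_order R,
    exists2 X, cofinal_in R X & X #= [set: K] &
    forall X, cofinal_in R X -> [set: K] #<= X].

Notation group_hom G H := (UMagmaMorphism.type G H).

Record inv_system := InvSystem {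
  grp :> nat -> groupType;
  proj : forall m n, (m <= n)%N -> group_hom (grp n) (grp m);
  proj_id : forall n (h : (n <= n)%N) x, proj h x = x;
  proj_comp : forall k m n (hkm : (k <= m)%N) (hmn : (m <= n)%N)
    (hkn : (k <= n)%N) x, proj hkm (proj hmn x) = proj hkn x
}.

Definition inv_lim (S : inv_system) : Type :=
  {f : forall n, S n | forall m n (h : (m <= n)%N), proj S h (f n) = f m}.

Section InverseLimitGroup.
Variable S : inv_system.
Implicit Types f g : inv_lim S.

Lemma inv_limP f g : (forall n, sval f n = sval g n) -> f = g.
Proof.
case: f g => [f fP] [g gP] /= fg; apply: eq_exist.
exact: functional_extensionality_dep.
Qed.

Definition lim_one : inv_lim S.
Proof. by exists (fun=> 1) => m n h; apply: gmulf1. Defined.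

Definition lim_mul f g : inv_lim S.
Proof.
exists (fun n => sval f n * sval g n) => m n h.
by rewrite gmulfM (svalP f) (svalP g).
Defined.

Definition lim_inv f : inv_lim S.
Proof. by exists (fun n => (sval f n)^-1) => m n h; rewrite gmulfV (svalP f). Defined.

Lemma lim_mulA : associative lim_mul.
Proof. by move=> f g h; apply: inv_limP => n /=; rewrite mulgA. Qed.
Lemma lim_mul1g : left_id lim_one lim_mul.
Proof. by move=> f; apply: inv_limP => n /=; rewrite mul1g. Qed.
Lemma lim_mulg1 : right_id lim_one lim_mul.
Proof. by move=> f; apply: inv_limP => n /=; rewrite mulg1. Qed.
Lemma lim_mulVg : left_inverse lim_one lim_inv lim_mul.
Proof. by move=> f; apply: inv_limP => n /=; rewrite mulVg. Qed.
Lemma lim_mulgV : right_inverse lim_one lim_inv lim_mul.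
Proof. by move=> f; apply: inv_limP => n /=; rewrite mulgV. Qed.

HB.instance Definition _ := gen_eqMixin (inv_lim S).
HB.instance Definition _ := gen_choiceMixin (inv_lim S).
HB.instance Definition _ :=
  isGroup.Build (inv_lim S) lim_mulA lim_mul1g lim_mulg1 lim_mulVg lim_mulgV.

Definition lim_proj (n : nat) f : S n := sval f n.

End InverseLimitGroup.

Record system (lam : cardinal) (I : Type) := System {
  lam_cof : [set: lam] #= [set: nat] \/ has_cofinality lam nat;
  card_I : [set: I] #<= [set: lam];
  sysG : inv_system;
  card_G : forall n, [set: sysG n] #<= [set: lam];
  triv_G0 : forall x : sysG 0, x = 1;
  sysH : I -> inv_system;
  card_H : forall t n, [set: sysH t n] #<= [set: lam];
  triv_H0 : forall t (x : sysH t 0), x = 1;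
  sigma : forall t n, group_hom (sysH t n) (sysG n);
  sigma_proj : forall t m n (h : (m <= n)%N) (x : sysH t n),
    proj sysG h (sigma t n x) = sigma t m (proj (sysH t) h x)
}.

Section Nu.
Variables (lam : cardinal) (I : Type) (A : system lam I).

Definition sigma_lim (t : I) (x : inv_lim (sysH A t)) : inv_lim (sysG A).
Proof.
exists (fun n => sigma A t n (sval x n)) => m n h.
by rewrite sigma_proj (svalP x).
Defined.

Definition eqE (t : I) (f g : inv_lim (sysG A)) : Prop :=
  range (@sigma_lim t) (f * g^-1).

(* The cardinals over which the supremum [nu] is taken. [mu] carries no
   order, so "equal projections to f_0" is rendered as "all projections equal"
   and "i < j" as "i <> j" (each [eqE t] is symmetric). *)
Definition nu_candidate (mu : cardinal) : Prop :=
  forall n : nat, exists f : mu -> inv_lim (sysG A),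
    ([set: mu] #<= [set: lam] ->
       forall i j, lim_proj n (f i) = lim_proj n (f j)) /\
    (forall i j t, i <> j -> ~ eqE t (f i) (f j)).

Definition nu_upper_bound (N : cardinal) : Prop :=
  forall mu, nu_candidate mu -> [set: mu] #<= [set: N].

(* [N] is the supremum nu(A): the least upper bound of the candidates. It
   exists as soon as [I] is inhabited (see [is_nu_exists]); for empty [I] every
   cardinal is a candidate and there is no supremum. *)
Definition is_nu (N : cardinal) : Prop :=
  nu_upper_bound N /\
  forall M, nu_upper_bound M -> [set: N] #<= [set: M].

End Nu.

Record explicit_system (lam : nat -> cardinal) (I : Type) (J : nat -> set I) :=
  ExplicitSystem {
  lam_incr : forall m n, (m < n)%N -> [set: lam m] #< [set: lam n];
  J_incr : forall m n, (m <= n)%N -> J m `<=` J n;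
  J_cover : \bigcup_n J n = [set: I];
  base_system :> system (cardinal_sum lam) I;
  card_J : forall n, J n #<= [set: lam n];
  card_Gn : forall n, [set: sysG base_system n] #<= [set: lam n];
  card_Hlt : forall t n, [set: sysH base_system t n] #< [set: cardinal_sum lam];
  card_Hincr : forall t n,
    [set: sysH base_system t n] #<= [set: sysH base_system t n.+1]
}.

Lemma card_leTP (T U : Type) :
  [set: T] #<= [set: U] <-> exists f : T -> U, injective f.
Proof.
split=> [/card_leP[f]|[f fI]].
  exists (fun x => val (f (SigSub (mem_set (Logic.I : [set: T] x))))) => x y.
  by move=> /val_inj/(@inj _ _ _ f); rewrite !inE => /(_ Logic.I Logic.I) [].
have /injfunPex[g] : exists2 g : T -> U, set_fun setT setT g & set_inj setT g.
  by exists f => // x y _ _; apply: fI.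
exact: inj_card_le.
Qed.

Lemma card_least (S : Type) (T : S -> Type) : S ->
  exists s, forall u, [set: T s] #<= [set: T u].
Proof.
move=> s0.
pose P := [set X : set (forall s, T s) |
  forall x y, X x -> X y -> forall s, x s = y s -> x = y].
have [X [PX Xmax]] : exists X, P X /\ forall Y, X `<` Y -> ~ P Y.
  apply: Zorn_bigcup => F FP Ftot x y [U FU Ux] [V FV Vy] s xy.
  have [UV|VU] := Ftot _ _ FU FV.
    by apply: (FP _ FV x y _ Vy s xy); apply: UV.
  by apply: (FP _ FU x y Ux _ s xy); apply: VU.
have [[s sX]|nS] := pselect (exists s, forall a, exists2 x, X x & x s = a).
  exists s => u; apply/card_leTP.
  have [g gP] : exists g : T s -> forall s, T s, forall a, X (g a) /\ g a s = a.
    exists (fun a => projT1 (cid2 (sX a))) => a.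
    by case: cid2.
  exists (fun a => g a u) => a b /(PX _ _ (gP a).1 (gP b).1) gab.
  by rewrite -(gP a).2 gab (gP b).2.
have out s : exists a, forall x, X x -> x s <> a.
  apply: contrapT => nex; apply: nS; exists s => a; apply: contrapT => na.
  by apply: nex; exists a => x Xx xa; apply: na; exists x.
pose z s := projT1 (cid (out s)).
have zP s x : X x -> x s <> z s by rewrite /z; case: cid => a /= /[apply].
case: (Xmax (X `|` [set z])); first split.
- by move=> x; left.
- by move=> /(_ z (or_intror erefl)) /(zP s0).
move=> x y [Xx|->] [Xy|->] s //.
- exact: PX.
- by move/(zP _ _ Xx).
- by move/esym/(zP _ _ Xy).
Qed.

Lemma card_le_total (T U : Type) :
  [set: T] #<= [set: U] \/ [set: U] #<= [set: T].
Proof.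
have [[] /= h] := card_least (fun b : bool => if b then T else U) true.
  by left; apply: (h false).
by right; apply: (h true).
Qed.

Lemma is_nu_exists (lam : cardinal) (I : Type) (A : system lam I) :
  inhabited I -> exists N, is_nu A N.
Proof.
move=> [t].
have ubG : nu_upper_bound A (inv_lim (sysG A)).
  move=> mu /(_ 0)[f [_ fE]]; apply/card_leTP; exists f => i j fij.
  apply: contrapT => /fE -/(_ t); apply; rewrite /eqE fij mulgV.
  by exists 1 => //; apply: inv_limP => n /=; apply: gmulf1.
pose S := {U : set (inv_lim (sysG A)) | nu_upper_bound A {x | U x}}.
have ubT : nu_upper_bound A {x : inv_lim (sysG A) | [set: inv_lim (sysG A)] x}.
  move=> mu /ubG /card_leTP[f fI]; apply/card_leTP.
  by exists (fun i => exist _ (f i) Logic.I) => i j [] /fI.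
pose T (s : S) : Type := {x | sval s x}.
have [[U ubU] Umin] := card_least T (exist _ setT ubT).
exists {x | U x}; split=> // M ubM.
have [/card_leTP[f fI]|GM] := card_le_total M (inv_lim (sysG A)); last first.
  apply: (card_le_trans _ GM); apply/card_leTP.
  by exists sval => x y /eq_sig_hprop; apply=> *; apply: Prop_irrelevance.
have ubf : nu_upper_bound A {x | range f x}.
  move=> mu /ubM/card_leTP[g gI]; apply/card_leTP.
  by exists (fun i => exist _ (f (g i)) (imageT f (g i))) => i j [] /fI/gI.
apply: (card_le_trans (Umin (exist _ (range f) ubf))); apply/card_leTP.
have /choice[h hP] : forall x : {x | range f x}, exists m, f m = sval x.
  by case=> x xf /=; case: xf => m _ mx; exists m.
exists h => x y exy; apply: eq_sig_hprop => [*|]; first exact: Prop_irrelevance.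
by rewrite -!hP exy.
Qed.

(* Main.v *)
(* For [h] in [H^t_k] and [f] in [G_omega], let [rk(h, f)] be the rank of the tree
of partial [sigma^t]-preimages of [f] above [h]; it is infinite iff [h] extends
to a preimage of [f] in [H^t_omega]. It behaves like a valuation:
[rk(h h', f f') >= min (rk(h, f), rk(h', f'))].

The elements [a_s] are built along a tree with [n]-th splitting [2^lambda_n],
with [a_(s,x) = f_(s,x) a_s] and [f_(s,x)] trivial in [G_n], so that branches
converge in [G_omega]. Along two branches the quotients [y = a_s a_s'^-1] evolve
as [y |-> f y f'^-1]. At each stage the factors are chosen so that, for the
fewer than [lambda] many relevant [t], [h], [y], this never increases
[rk(h, y)], and [f y f'^-1] is outside the range of [sigma^t_omega]. A preimage
[h] of the limit of the quotients would then give an infinite descending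
sequence of ranks [rk(h_k, y_n)].

Such factors exist because [lambda] is a strong limit. Take a large family of
elements trivial in [G_n], pairwise inequivalent for all [t]. By Erdos-Rado one
may assume that for each [(t, h, y)] either all or none of the quotients
[f_i f_j^-1] have [rk(1, f_i f_j^-1) > rk(h, y)]. Translate the family by one of
its members: in the first case all [rk(1, f_i) > rk(h, y)], so that
[rk(h, f_i y f_j^-1) = rk(h, y)]; in the second case [rk(h, f_i y f_j^-1) >
rk(h, y)] holds for at most one [i] for each [j] and vice versa, and a second
use of Erdos-Rado removes these pairs. *)
Require Import Defs.
From mathcomp Require Import all_boot.
From mathcomp Require Import boolp classical_sets functions cardinality.
From mathcomp Require Import wochoice.

Set Implicit Arguments.
Unset Strict Implicit.
Unset Printing Implicit Defensive.

Local Open Scope classical_set_scope.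
Local Open Scope card_scope.
Local Open Scope group_scope.

(** * Comparison of cardinals, pigeonhole and well-orders *)

Lemma sval_inj (T : Type) (P : T -> Prop) : injective (@sval T P).
Proof. by move=> [x p] [y q] /= xy; apply: eq_exist. Qed.

Lemma card_le_inj (T U : Type) (f : T -> U) :
  injective f -> [set: T] #<= [set: U].
Proof. by move=> fI; apply/card_leTP; exists f. Qed.

Lemma card_le_setT (T U : Type) :
  [set: T] #<= [set: U] -> [set: set T] #<= [set: set U].
Proof.
move=> /card_leTP[f fI]; apply: (@card_le_inj _ _ (fun X => f @` X)) => X Y XY.
apply/seteqP; split=> x Xx.
  by have [y Yy /fI <-] : (f @` Y) (f x) by rewrite -XY; exists x.
by have [y Yy /fI <-] : (f @` X) (f x) by rewrite XY; exists x.
Qed.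

Lemma card_le_prod (T T' U U' : Type) : [set: T] #<= [set: T'] ->
  [set: U] #<= [set: U'] -> [set: T * U] #<= [set: T' * U'].
Proof.
move=> /card_leTP[f fI] /card_leTP[g gI].
by apply: (@card_le_inj _ _ (fun p => (f p.1, g p.2))) => -[x y] [x' y'] []
  /fI -> /gI ->.
Qed.

Lemma cantor (T : Type) : ~ ([set: set T] #<= [set: T]).
Proof.
move=> /card_leTP[f fI]; pose D := [set x | exists2 X, f X = x & ~ X x].
have [DD|nDD] := pselect (D (f D)); last by apply: (nDD); exists D.
by have [X /fI -> ] := DD; apply.
Qed.

(* Kuratowski pairs. *)
Lemma card_le_square (T : Type) : [set: T * T] #<= [set: set (set T)].
Proof.
apply: (@card_le_inj _ _ (fun p => [set [set p.1]; [set p.1; p.2]])).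
move=> [x y] [x' y'] /= e.
have xx : x = x'.
  have : [set [set x']; [set x'; y']] [set x] by rewrite -e; left.
  case=> xE; [have: [set x] x' by rewrite xE | have: [set x] x' by rewrite xE; left].
    by move->.
  by move->.
subst x'.
have : [set [set x]; [set x; y']] [set x; y] by rewrite -e; right.
have : [set [set x]; [set x; y]] [set x; y'] by rewrite e; right.
move=> h1 h2.
have h1' : [set x; y] y'.
  by case: h1 => [h|<-]; [left; have : [set x] y' by rewrite -h; right | right].
have h2' : [set x; y'] y.
  by case: h2 => [h|<-]; [left; have : [set x] y by rewrite -h; right | right].
by case: h1' => [y'x|->] //; case: h2' => [->|->] //; rewrite y'x.
Qed.

(** If every fibre of [c] embedded in [U], the fibres would assemble to an embedding of [T] into
    [C * U]. A fibre that does not embed receives [U]. *)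
Lemma card_pigeonhole (T C U : Type) (c : T -> C) :
  ~ ([set: T] #<= [set: C * U]) ->
  exists c0, exists2 s : U -> T, injective s & forall u, c (s u) = c0.
Proof.
move=> big; apply: contrapT => nex; apply: big.
have eP c0 : exists e : {x | c x = c0} -> U, injective e.
  have [/card_leTP//|/card_leTP[s sI]] := card_le_total {x | c x = c0} U.
  exfalso; apply: nex; exists c0, (fun u => sval (s u)); last by move=> u; case: (s u).
  exact: inj_comp (@sval_inj _ _) sI.
pose e c0 := sval (cid (eP c0)); have eI c0 : injective (e c0) by rewrite /e; case: cid.
have eE x c0 (p : c x = c0) : e (c x) (exist _ x erefl) = e c0 (exist _ x p).
  by case: _ / p.
apply: (@card_le_inj _ _ (fun x => (c x, e (c x) (exist _ x erefl)))) => x y [cxy].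
by rewrite (eE _ _ cxy) => /eI[].
Qed.

Lemma strict_well_order (F : Type) : exists lt : F -> F -> Prop,
  [/\ well_founded lt, forall x y z, lt x y -> lt y z -> lt x z &
      forall x y, [\/ lt x y, lt y x | x = y]].
Proof.
have [R Rwo] := @well_ordering_principle {classic F}.
have Rmin (X : set F) : X !=set0 -> exists2 x, X x & forall y, X y -> R x y.
  move=> [x Xx]; have [|z [[/asboolP Xz zmin] _]] := Rwo [pred y | `[< X y >]].
    by exists x; apply/asboolP.
  by exists z => // y Xy; apply: zmin; apply/asboolP.
have Rtot x y : R x y \/ R y x.
  have [|z [->|->] zmin] := Rmin [set x; y]; first by exists x; left.
    by left; apply: zmin; right.
  by right; apply: zmin; left.
have Rxx x : R x x by case: (Rtot x x).
have Ranti x y : R x y -> R y x -> x = y.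
  move=> xy yx; have [|z [_ zuniq]] := Rwo [pred z | (z == x) || (z == y)].
    by exists x; rewrite inE eqxx.
  rewrite -(zuniq x) ?(zuniq y) //; split; rewrite ?inE ?eqxx ?orbT //;
    by move=> u /orP[] /eqP->.
exists (fun x y => R x y /\ x <> y); split=> [x|x y z [xy nxy] [yz nyz]|x y].
- apply: contrapT => nx.
  have [|z zn zmin] := Rmin [set z | ~ Acc (fun x y => R x y /\ x <> y) z].
    by exists x.
  apply: zn; constructor => y [yz nyz]; apply: contrapT => ny; apply: nyz.
  by apply: Ranti => //; apply: zmin.
- have [|u [[]|] -> umin] := Rmin [set x; y; z]; first by exists x; do 2 left.
  + split; first by apply: umin; right.
    by move=> xz; apply: nxy; apply: Ranti => //; rewrite xz.
  + by case: nxy; apply: Ranti => //; apply: umin; do 2 left.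
  + by case: nyz; apply: Ranti => //; apply: umin; left; right.
- have [->|xy] := pselect (x = y); first by constructor 3.
  by case: (Rtot x y) => h; [constructor 1|constructor 2]; split=> // /esym.
Qed.

(** * The Erdos-Rado partition theorem for pairs *)

Section ErdosRado.
Variables (F C : Type) (c : F -> F -> C).
Variables (lt : F -> F -> Prop) (lt_wf : well_founded lt).
Hypothesis lt_trans : forall x y z, lt x y -> lt y z -> lt x z.
Hypothesis lt_tot : forall x y, [\/ lt x y, lt y x | x = y].

Let lt_irr x : ~ lt x x.
Proof. by elim: (lt_wf x) => {}x _ IH xx; apply: (IH x xx xx). Qed.

(* The Erdos-Rado tree order: [k] precedes [i] when [k < i] and [k], [i] get the
same colours with all tree predecessors of [k]. *)
Definition tree_lt : F -> F -> Prop :=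
  Fix lt_wf (fun=> F -> Prop) (fun k rec i =>
    lt k i /\ forall l (lk : lt l k), rec l lk k -> c l k = c l i).

Lemma tree_ltE k i : tree_lt k i <->
  lt k i /\ forall l, tree_lt l k -> c l k = c l i.
Proof.
have E k' i' : tree_lt k' i' =
    (lt k' i' /\ forall l, lt l k' -> tree_lt l k' -> c l k' = c l i').
  rewrite /tree_lt Fix_eq // => x f g fg; have -> // : f = g.
  apply: functional_extensionality_dep => y.
  exact: functional_extensionality_dep.
rewrite E; split=> -[ki h]; split=> // l; last by move=> _; apply: h.
by move=> lk; apply: h => //; move: lk; rewrite E => -[].
Qed.

Lemma tree_lt_lt k i : tree_lt k i -> lt k i.
Proof. by case/tree_ltE. Qed.

Lemma tree_lt_color l k i : tree_lt l k -> tree_lt k i -> c l k = c l i.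
Proof. by move=> lk /tree_ltE[_]; apply. Qed.

Lemma tree_lt_trans l k i : tree_lt l k -> tree_lt k i -> tree_lt l i.
Proof.
elim: (lt_wf l) k i => {}l _ IH k i lk ki; apply/tree_ltE; split.
  by apply: lt_trans (tree_lt_lt ki); apply: tree_lt_lt.
move=> m ml; rewrite (tree_lt_color ml lk).
exact: tree_lt_color (IH _ (tree_lt_lt ml) _ _ ml lk) ki.
Qed.

(** The tree predecessors of [i] form a chain: the colours of [l] with [k] and with [j] both equal
    its colour with [i]. *)
Lemma tree_lt_comparable k j i :
  tree_lt k i -> tree_lt j i -> lt k j -> tree_lt k j.
Proof.
elim: (lt_wf k) => {}k _ IH ki ji kj; apply/tree_ltE; split=> // l lk.
have li := tree_lt_trans lk ki.
have lj := IH _ (tree_lt_lt lk) li ji (lt_trans (tree_lt_lt lk) kj).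
by rewrite (tree_lt_color lk ki) (tree_lt_color lj ji).
Qed.

(* A point is determined by the order type of its set of predecessors together
with its colours with them. *)
Lemma tree_code (T : Type) :
  (forall i, [set: {k | tree_lt k i}] #<= [set: T]) ->
  [set: F] #<= [set: set (T * T) * set (T * C)].
Proof.
move=> small; pose e i := sval (cid ((card_leTP _ _).1 (small i))).
have eI i : injective (e i) by rewrite /e; case: cid.
pose E i k u := exists p : tree_lt k i, e i (exist _ k p) = u.
have E_dom i k u : E i k u -> tree_lt k i by case.
have E_tot i k : tree_lt k i -> exists u, E i k u.
  by move=> ki; exists (e i (exist _ k ki)), ki.
have E_inj i k j u : E i k u -> E i j u -> k = j.
  move=> [p pu] [q qu]; suff [] : exist (tree_lt^~ i) k p = exist _ j q by [].
    by apply: (eI i); rewrite pu qu.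
pose A i := [set p : T * T | exists k j, [/\ E i k p.1, E i j p.2 & lt k j]].
pose B i := [set p : T * C | exists2 k, E i k p.1 & c k i = p.2].
apply: (@card_le_inj _ _ (fun i => (A i, B i))).
have pred_same i i' : A i = A i' -> B i = B i' ->
    forall k u, E i k u -> E i' k u /\ c k i = c k i'.
  move=> AA BB; elim/(well_founded_ind lt_wf) => k IH u ku.
  have [k' /= k'u cc] : B i' (u, c k i) by rewrite -BB; exists k.
  suff kk' : k' = k by rewrite kk' in k'u cc.
  have ki := E_dom _ _ _ ku; have k'i := E_dom _ _ _ k'u.
  have fwd l : tree_lt l i -> lt l k ->
      [/\ tree_lt l i', lt l k' & c l i = c l i'].
    move=> /E_tot[v lv] lk; have [lv' cl] := IH _ lk _ lv.
    have [l2 [k2 /= [l2v k2u lk2]]] : A i' (v, u) by rewrite -AA; exists l, k.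
    rewrite (E_inj _ _ _ _ lv' l2v) (E_inj _ _ _ _ k'u k2u) in cl *; split=> //.
    exact: E_dom l2v.
  have bwd l : tree_lt l i' -> lt l k' -> tree_lt l i /\ lt l k.
    move=> /E_tot[v lv] lk.
    have [l2 [k2 /= [l2v k2u lk2]]] : A i (v, u) by rewrite AA; exists l, k'.
    rewrite -(E_inj _ _ _ _ ku k2u) in lk2.
    have [/(E_inj _ _ _ _ lv)-> _] := IH _ lk2 _ l2v.
    by split=> //; apply: E_dom l2v.
  have col l : tree_lt l i -> lt l k -> c l k = c l k'.
    move=> li lk; have [li' lk' cl] := fwd l li lk.
    rewrite (tree_lt_color (tree_lt_comparable li ki lk) ki) cl.
    by rewrite (tree_lt_color (tree_lt_comparable li' k'i lk') k'i).
  (* If [k] and [k'] differ, the smaller is a tree predecessor of the larger; transferred to the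
     other side, it lies below itself. *)
  case: (lt_tot k k') => // [kk'|k'k].
  - have /tree_lt_trans/(_ k'i) ki' : tree_lt k k'.
      apply/tree_ltE; split=> // l lk; apply: col; last exact: tree_lt_lt.
      exact: tree_lt_trans ki.
    by have [_ /lt_irr] := bwd k ki' kk'.
  - have /tree_lt_trans/(_ ki) k'i2 : tree_lt k' k.
      apply/tree_ltE; split=> // l lk'.
      have [li lk] := bwd l (tree_lt_trans lk' k'i) (tree_lt_lt lk').
      by rewrite col.
    by have [_ /lt_irr] := fwd k' k'i2 k'k.
(* Equal codes would make [i] a tree predecessor of [i'] and hence, by [pred_same], of itself. *)
have half i i' : A i = A i' -> B i = B i' -> ~ lt i i'.
  move=> AA BB ii'.
  have /E_tot[u /(pred_same _ _ (esym AA) (esym BB))[/E_dom/tree_lt_lt/lt_irr//]] :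
    tree_lt i i'.
  apply/tree_ltE; split=> // l /E_tot[u /(pred_same _ _ AA BB)[_ //]].
move=> i i' [AA BB]; case: (lt_tot i i') => // [/(half _ _ AA BB)//|].
by move=> /(half _ _ (esym AA) (esym BB)).
Qed.

End ErdosRado.

(** By [tree_code] some [i] has too many tree predecessors to embed in [C * T]. Among them, [T] many
    share their colour with [i], and this is the colour of any two of them. *)
Lemma erdos_rado (F C T : Type) (c : F -> F -> C) :
  (forall i j, c i j = c j i) ->
  ~ ([set: F] #<= [set: set ((C * T) * (C * T)) * set ((C * T) * C)]) ->
  exists2 s : T -> F, injective s &
    exists c0, forall a b, a <> b -> c (s a) (s b) = c0.
Proof.
move=> c_sym big; have [lt [lt_wf lt_trans lt_tot]] := strict_well_order F.
have [i iB] : exists i, ~ ([set: {k | tree_lt c lt_wf k i}] #<= [set: C * T]).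
  apply: contrapT => nex; apply: big.
  apply: (tree_code lt_trans lt_tot (c := c) (lt_wf := lt_wf)) => i.
  by apply: contrapT => iB; apply: nex; exists i.
have [c0 [s sI sc]] := card_pigeonhole (fun k => c (sval k) i) iB.
exists (fun a => sval (s a)); first exact: inj_comp (@sval_inj _ _) sI.
exists c0 => a b ab.
have main (k j : {k | tree_lt c lt_wf k i}) :
    lt (sval k) (sval j) -> c (sval k) (sval j) = c (sval k) i.
  move=> kj; apply: (tree_lt_color _ (svalP j)).
  exact: (tree_lt_comparable lt_trans (svalP k) (svalP j) kj).
have [/main->|/main|/sval_inj/sI//] := lt_tot (sval (s a)) (sval (s b)).
- exact: sc.
- by rewrite c_sym => ->; apply: sc.
Qed.

(** * Types of cardinality below lambda *)

Section SmallTypes.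
Variable lam : nat -> cardinal.
Hypothesis lam_incr : forall m n, (m < n)%N -> [set: lam m] #< [set: lam n].
Hypothesis lam_sl : strong_limit (cardinal_sum lam).
Hypothesis lam_gt_nat : [set: nat] #< [set: cardinal_sum lam].
Notation L := (cardinal_sum lam).

Definition small (T : Type) := exists n, [set: T] #<= [set: lam n].

Lemma lam_le m n : (m <= n)%N -> [set: lam m] #<= [set: lam n].
Proof. by rewrite leq_eqVlt => /predU1P[->//|/lam_incr[]]. Qed.

Lemma lam_le_sum n : [set: lam n] #<= [set: L].
Proof. by apply: (@card_le_inj _ _ (existT lam n)); apply: existT_inj2. Qed.

Lemma sum_not_small : ~ small L.
Proof.
move=> [n Ln]; have [_] := lam_incr (ltnSn n); apply.
exact: card_le_trans (lam_le_sum n.+1) Ln.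
Qed.

Lemma small_lt n : [set: lam n] #< [set: L].
Proof. by split; [exact: lam_le_sum | move=> h; apply: sum_not_small; exists n]. Qed.

Lemma small_le T U : [set: T] #<= [set: U] -> small U -> small T.
Proof. by move=> TU [n Un]; exists n; apply: card_le_trans Un. Qed.

(** If [T] were at least every [lam n], $\lambda$ would embed in $\aleph_0\cdot|T|$, hence in the
    square of a cardinal below $\lambda$. But squares embed in double power sets, and $\lambda$ is a
    strong limit. *)
Lemma lt_small (T : cardinal) : [set: T] #< [set: L] -> small T.
Proof.
move=> TL; apply: contrapT => big.
have lamT n : [set: lam n] #<= [set: T].
  by have [//|Tn] := card_le_total (lam n) T; case: big; exists n.
have LT : [set: L] #<= [set: nat * T].
  pose e n := sval (cid ((card_leTP _ _).1 (lamT n))).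
  have eI n : injective (e n) by rewrite /e; case: cid.
  apply: (@card_le_inj _ _ (fun p : L => (projT1 p, e (projT1 p) (projT2 p)))).
  by move=> [m x] [n y] /= [mn]; move: y; rewrite -mn => y /eI ->.
have square (U : cardinal) : [set: U] #< [set: L] -> ~ ([set: L] #<= [set: U * U]).
  move=> /lam_sl/lam_sl[_ UL] LU; apply: UL.
  exact: card_le_trans LU (card_le_square U).
have [Tn|nT] := card_le_total T nat.
  apply: square lam_gt_nat _; apply: card_le_trans LT _.
  exact: card_le_prod.
apply: square TL _; apply: card_le_trans LT _; exact: card_le_prod.
Qed.

Lemma small_nat : small nat.
Proof. exact: lt_small. Qed.

Lemma small_set T : small T -> small (set T).
Proof.
move=> [n Tn]; apply: small_le (card_le_setT Tn) _.
exact/lt_small/lam_sl/small_lt.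
Qed.

Lemma small_prod T U : small T -> small U -> small (T * U).
Proof.
move=> [m Tm] [n Un]; pose k := maxn m n.
apply: (@small_le _ (lam k * lam k)).
  apply: card_le_prod; [apply: card_le_trans Tm _ | apply: card_le_trans Un _];
  by apply: lam_le; rewrite ?leq_maxl ?leq_maxr.
apply: small_le (card_le_square _) _.
by do 2 apply: small_set; exists k.
Qed.

Lemma small_sum T U : small T -> small U -> small (T + U).
Proof.
move=> [m Tm] [n Un]; pose k := maxn m n.
have /card_leTP[f fI] : [set: T] #<= [set: lam k].
  by apply: card_le_trans Tm (lam_le _); rewrite leq_maxl.
have /card_leTP[g gI] : [set: U] #<= [set: lam k].
  by apply: card_le_trans Un (lam_le _); rewrite leq_maxr.
apply: (@small_le _ (nat * lam k)); last first.
  by apply: small_prod; [exact: small_nat | exists k].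
apply: (@card_le_inj _ _ (fun z => match z with inl x => (0%N, f x) | inr y => (1%N, g y) end)).
by move=> [x|y] [x'|y'] [] // => [/fI->|/gI->].
Qed.

End SmallTypes.

(** * Comparison of ranks *)

Section Rank.
Variables (L : cardinal) (I : Type) (A : system L I) (t : I).
Notation Gw := (inv_lim (sysG A)).
Notation H := (sysH A t).
Implicit Types f g : Gw.

(* A node of the tree of partial [sigma_lim]-preimages of [f] extending [h]. *)
Definition child f k (h : H k) (h1 : H k.+1) : Prop :=
  proj H (leqnSn k) h1 = h /\ sigma A t k.+1 h1 = lim_proj k.+1 f.

(* [rank_gt f g h h'] says that the tree of partial preimages of [f] above [h]
has larger rank than the one of [g] above [h']; ill-founded trees have rank
infinity, which is not larger than itself. *)
Inductive rank_gt f g k (h h' : H k) : Prop :=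
  RankGt h1 of child f h h1 &
    (forall h1', child g h' h1' -> rank_gt f g h1 h1').

(** Well-foundedness of the tree above [h], that is, $rk(h,f)<\infty$. *)
Inductive ranked f k (h : H k) : Prop :=
  Ranked of (forall h1, child f h h1 -> ranked f h1).

Lemma child_mul f f' k (h h' : H k) h1 h1' :
  child f h h1 -> child f' h' h1' -> child (f * f') (h * h') (h1 * h1').
Proof. by move=> [p s] [p' s']; split; rewrite !gmulfM ?p ?p' ?s ?s'. Qed.

Lemma child_inv f k (h : H k) h1 : child f h h1 -> child f^-1 h^-1 h1^-1.
Proof. by move=> [p s]; split; rewrite !gmulfV ?p ?s. Qed.

Lemma rank_gt_mul f f' g k (h h' u : H k) :
  rank_gt f g h u -> rank_gt f' g h' u -> rank_gt (f * f') g (h * h') u.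
Proof.
move=> fu; elim: fu h' => {}k {}h {}u h1 fh1 _ IH h' [h1' fh1' hu].
exists (h1 * h1'); first exact: child_mul.
by move=> u1 gu1; apply: IH => //; apply: hu.
Qed.

Lemma rank_gt_inv f g k (h u : H k) :
  rank_gt f g h u -> rank_gt f^-1 g h^-1 u.
Proof.
elim=> {}k {}h {}u h1 fh1 _ IH; exists h1^-1 => //; exact: child_inv.
Qed.

Lemma rank_gt_irr f k (h : H k) : ~ rank_gt f f h h.
Proof.
suff neq h' : rank_gt f f h h' -> h <> h' by move=> /neq.
by elim=> {}k {}h {}h' h1 fh1 _ IH hh'; apply: (IH h1) => //; rewrite -hh'.
Qed.

Lemma not_rank_gt_child f g k (h u : H k) h1 : ~ rank_gt f g h u ->
  child f h h1 -> exists2 u1, child g u u1 & ~ rank_gt f g h1 u1.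
Proof.
move=> nfg fh1; apply: contrapT => nex; apply: nfg; exists h1 => // u1 gu1.
by apply: contrapT => ?; apply: nex; exists u1.
Qed.

(** Negative transitivity stands in for the linear order of the ranks, which are never formed as
    ordinals. *)
Lemma rank_gt_cotrans f g e k (h u v : H k) :
  rank_gt f e h v -> rank_gt f g h u \/ rank_gt g e u v.
Proof.
move=> fv; elim: fv u => {}k {}h {}v h1 fh1 _ IH u.
have [|nfg] := pselect (rank_gt f g h u); [by left|right].
have [u1 gu1 nfg1] := not_rank_gt_child nfg fh1.
by exists u1 => // v1 ev1; have [] := IH _ ev1 u1.
Qed.

Lemma not_ranked_range f (h : H 0) :
  ~ ranked f h -> range (@sigma_lim _ _ A t) f.
Proof.
move=> nrk.
pose node := {k : nat & {h : H k | ~ ranked f h}}.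
have next (k : nat) (x : {h : H k | ~ ranked f h}) :
    {y : {h : H k.+1 | ~ ranked f h} | child f (sval x) (sval y)}.
  apply: cid; apply: contrapT => nex; apply: (svalP x); constructor.
  by move=> y xy; apply: contrapT => ny; apply: nex; exists (exist (fun h => ~ ranked f h) y ny).
pose b := fix b k : {h : H k | ~ ranked f h} :=
  if k is k'.+1 then sval (next k' (b k')) else exist _ h nrk.
have bP k : child f (sval (b k)) (sval (b k.+1)) by exact: (svalP (next k (b k))).
have bproj m n (mn : (m <= n)%N) : proj H mn (sval (b n)) = sval (b m).
  elim: n mn => [|n IH] mn.
    have m0 : m = 0%N by apply/eqP; rewrite -leqn0.
    by subst m; apply: proj_id.
  have [mE|mn'] : m = n.+1 \/ (m <= n)%N.
    by case: ltngtP mn => // [|->] *; [right|left].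
    by subst m; apply: proj_id.
  by rewrite -(IH mn') -(bP n).1; apply/esym/proj_comp.
exists (exist _ (fun k => sval (b k)) bproj) => //; apply: inv_limP => -[|k] /=.
  (* [child] does not constrain the image in $G_0$, but this group is trivial. *)
  by rewrite (triv_G0 (sval f 0)) (triv_G0 (sigma _ _ _ _)).
exact: (bP k).2.
Qed.

End Rank.

(** * One stage of the construction *)

(** The bound of [erdos_rado] is exceeded by its power set, which is still small because $\lambda$
    is a strong limit. *)
Lemma small_partition (lam : nat -> cardinal)
    (lam_incr : forall m n, (m < n)%N -> [set: lam m] #< [set: lam n])
    (lam_sl : strong_limit (cardinal_sum lam))
    (lam_gt_nat : [set: nat] #< [set: cardinal_sum lam]) (T C : Type) :
  small lam T -> small lam C -> exists2 F : Type, small lam F &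
    forall c : F -> F -> C, (forall i j, c i j = c j i) ->
      exists2 s : T -> F, injective s &
        exists c0, forall a b, a <> b -> c (s a) (s b) = c0.
Proof.
move=> sT sC; exists (set (set ((C * T) * (C * T)) * set ((C * T) * C))).
  by do !(apply: small_set || apply: small_prod).
by move=> c c_sym; apply: erdos_rado => //; apply: cantor.
Qed.

Section Stage.
Variable lam : nat -> cardinal.
Hypothesis lam_incr : forall m n, (m < n)%N -> [set: lam m] #< [set: lam n].
Hypothesis lam_sl : strong_limit (cardinal_sum lam).
Hypothesis lam_gt_nat : [set: nat] #< [set: cardinal_sum lam].
Variables (I : Type) (A : system (cardinal_sum lam) I).
Notation Gw := (inv_lim (sysG A)).
Notation small := (small lam).
Notation K t := (range (@sigma_lim _ _ A t)).

Lemma range_mul t (f g : Gw) : K t f -> K t g -> K t (f * g).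
Proof.
move=> [x _ <-] [y _ <-]; exists (x * y) => //.
by apply: inv_limP => n /=; rewrite gmulfM.
Qed.

Lemma range_inv t (f : Gw) : K t f -> K t f^-1.
Proof.
move=> [x _ <-]; exists x^-1 => //; by apply: inv_limP => n /=; rewrite gmulfV.
Qed.

(** The form in which $\operatorname{nu}\ge\lambda$ enters the construction; see
    [nu_small_families]. *)
Definition has_small_families := forall m (T : Type), small T ->
  exists2 f : T -> Gw, forall a, lim_proj m (f a) = 1 &
    forall a b t, a <> b -> ~ Defs.eqE t (f a) (f b).

Hypothesis families : has_small_families.

Lemma stage m (X T : Type) (t : X -> I) (k : X -> nat)
    (h : forall x, sysH A (t x) (k x)) (y : X -> Gw) : small X -> small T ->
  exists2 f : T -> Gw, forall a, lim_proj m (f a) = 1 &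
    forall a b x, a <> b -> ~ K (t x) (f a * y x * (f b)^-1) /\
      ~ rank_gt (f a * y x * (f b)^-1) (y x) (h x) (h x).
Proof.
move=> sX sT.
(* The points of [nat] are spare vertices, used in [d0_empty] to refute a nonempty homogeneous
   colour. *)
have sTN : small (T + nat) by apply: small_sum => //; apply: small_nat.
have [S sS partS] : exists2 S : Type, small S &
    forall c : S -> S -> set (X * bool), (forall i j, c i j = c j i) ->
      exists2 s : T + nat -> S, injective s &
        exists c0, forall a b, a <> b -> c (s a) (s b) = c0.
  apply: small_partition => //; apply: small_set => //; apply: small_prod => //.
  apply: (@small_le _ _ nat); last exact: small_nat.
  by apply: (@card_le_inj _ _ nat_of_bool); case; case.
(* The extra point [None] indexes the member used for translation, so that each [g a] is itself a
   quotient of the homogeneous colour. *)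
have [F sF partF] : exists2 F : Type, small F &
    forall c : F -> F -> set X, (forall i j, c i j = c j i) ->
      exists2 s : option S -> F, injective s &
        exists c0, forall a b, a <> b -> c (s a) (s b) = c0.
  apply: small_partition => //; last exact: small_set.
  apply: (@small_le _ _ (S + nat)).
    apply: (@card_le_inj _ _ (fun o => if o is Some a then inl a else inr 0%N)).
    by move=> [a|] [b|] // [->].
  by apply: small_sum => //; apply: small_nat.
have [f fm fE] := families m sF.
pose far (u : Gw) x := rank_gt u (y x) (1 : sysH A (t x) (k x)) (h x).
have far_inv u x : far u x -> far u^-1 x.
  by move=> ux; rewrite /far -[1]invg1; apply: rank_gt_inv.
pose c i j := [set x | far (f i * (f j)^-1) x].
have [|s sI [c0 c0E]] := partF c.
  by move=> i j; apply/seteqP; split=> x /= /far_inv; rewrite invgM invgK.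
pose g a := f (s (Some a)) * (f (s None))^-1.
have gE a b : g a * (g b)^-1 = f (s (Some a)) * (f (s (Some b)))^-1.
  by rewrite /g !gnorm.
have g_far a b x : a <> b -> far (g a * (g b)^-1) x -> c0 x.
  by move=> ab; rewrite gE -(c0E (Some a) (Some b)) // => -[].
have c0_far a x : c0 x -> far (g a) x.
  by rewrite -(c0E (Some a) None).
have gK a b v : K v (g a * (g b)^-1) -> a = b.
  rewrite gE => Kab; apply: contrapT => ab; apply: (fE (s (Some a)) (s (Some b)) v _ Kab).
  by move=> /sI [].
pose bad (z : X * bool) a b := if z.2 then K (t z.1) (g a * y z.1 * (g b)^-1)
  else rank_gt (g a * y z.1 * (g b)^-1) (y z.1) (h z.1) (h z.1).
(* Otherwise $y=g_a^{-1}(g_a y g_b^{-1})g_b$ would have a larger rank above $h$ than itself. *)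
have bad_not_c0 x a b : c0 x -> ~ bad (x, false) a b.
  rewrite /bad /= => c0x ab; apply: (@rank_gt_irr _ _ _ _ (y x) _ (h x)).
  have := rank_gt_mul (rank_gt_mul (rank_gt_inv (c0_far a x c0x)) ab) (c0_far b x c0x).
  by rewrite !gnorm.
(* Dividing the two bad values leaves $g_a g_{a'}^{-1}$. If $a\ne a'$, it would be in the range,
   against inequivalence, or [far], forcing [c0 x], which [bad_not_c0] excludes. *)
have bad_l z a a' b : bad z a b -> bad z a' b -> a = a'.
  have E v : g a * v * (g b)^-1 * (g a' * v * (g b)^-1)^-1 = g a * (g a')^-1.
    by rewrite !gnorm.
  case: z => x [] ab a'b; first by apply: (gK _ _ (t x)); rewrite -(E (y x));
    apply: range_mul => //; apply: range_inv.
  apply: contrapT => aa'; apply: (bad_not_c0 x a b) => //; apply: (g_far a a') => //.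
  by have := rank_gt_mul ab (rank_gt_inv a'b); rewrite E mulgV.
have bad_r z a b b' : bad z a b -> bad z a b' -> b = b'.
  have E v : (g a * v * (g b)^-1)^-1 * (g a * v * (g b')^-1) = g b * (g b')^-1.
    by rewrite !gnorm.
  case: z => x [] ab ab'; first by apply: (gK _ _ (t x)); rewrite -(E (y x));
    apply: range_mul => //; apply: range_inv.
  apply: contrapT => bb'; apply: (bad_not_c0 x a b) => //; apply: (g_far b b') => //.
  by have := rank_gt_mul (rank_gt_inv ab) ab'; rewrite E mulVg.
pose d a b := [set z | bad z a b \/ bad z b a].
have [|r rI [d0 d0E]] := partS d.
  by move=> a b; apply/seteqP; split=> z [?|?]; [right|left|right|left].
(* A colour [z] would give three [z]-neighbours to one point, whereas it has at
most one on either side. *)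
have d0_empty z : ~ d0 z.
  move=> d0z.
  have nb n : (0 < n)%N -> bad z (r (inr 0%N)) (r (inr n)) \/ bad z (r (inr n)) (r (inr 0%N)).
    move=> n0; have // : d (r (inr 0%N)) (r (inr n)) z.
    by rewrite d0E // => -[n0']; rewrite -n0' in n0.
  have two_l i j : i <> j ->
      bad z (r (inr 0%N)) (r (inr i)) -> ~ bad z (r (inr 0%N)) (r (inr j)).
    by move=> ij bi bj; have /rI[/ij] := bad_r _ _ _ _ bi bj.
  have two_r i j : i <> j ->
      bad z (r (inr i)) (r (inr 0%N)) -> ~ bad z (r (inr j)) (r (inr 0%N)).
    by move=> ij bi bj; have /rI[/ij] := bad_l _ _ _ _ bi bj.
  have [b1|b1] := nb 1%N isT; have [b2|b2] := nb 2 isT; have [b3|b3] := nb 3 isT;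
    solve [ exact: two_l b1 b2 | exact: two_l b1 b3 | exact: two_l b2 b3
          | exact: two_r b1 b2 | exact: two_r b1 b3 | exact: two_r b2 b3 ].
exists (fun a => g (r (inl a))) => [a|a b x ab].
  by rewrite /g; have := fm (s (Some (r (inl a)))); have := fm (s None);
    rewrite /lim_proj /= => -> ->; rewrite mulgV.
have abE : inl a <> inl b :> T + nat by case.
by split=> xab; [apply: (d0_empty (x, true))|apply: (d0_empty (x, false))];
  rewrite -(d0E _ _ abE); left.
Qed.

End Stage.

(** * The tree of approximations *)

(** Instead of an explicit descending sequence, the claim [no] shows that above a preimage [z] the
    rank of [x n] eventually exceeds every ordinal rank, its own included. *)
Lemma range_descent (L : cardinal) (I : Type) (A : system L I) (t : I)
    (x : nat -> inv_lim (sysG A)) (y : inv_lim (sysG A)) :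
  (forall k n, (k <= n)%N -> lim_proj k (x n) = lim_proj k y) ->
  (exists N, forall n, (N <= n)%N -> ~ range (@sigma_lim _ _ A t) (x n)) ->
  (forall k, exists N, forall n, (N <= n)%N ->
     forall h : sysH A t k, ~ rank_gt (x n.+1) (x n) h h) ->
  ~ range (@sigma_lim _ _ A t) y.
Proof.
move=> xy [N xN] /choice[M xM] [z _ zy].
have child_z k n : (k < n)%N -> child (x n) (sval z k) (sval z k.+1).
  by move=> kn; split; [exact: svalP z _ _ _ | rewrite xy // -zy].
have mono g k (u : sysH A t k) n n' : (M k <= n)%N -> (n <= n')%N ->
    ~ rank_gt (x n) g (sval z k) u -> ~ rank_gt (x n') g (sval z k) u.
  move=> Mn /subnK <-; elim: (n' - n)%N => // j IH /IH nxg.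
  move=> /(rank_gt_cotrans (x (j + n)%N) (sval z k))[|//].
  by apply: xM; apply: leq_trans Mn _; apply: leq_addl.
have no g k (u : sysH A t k) : ranked g u ->
    forall n, (M k <= n)%N -> rank_gt (x n) g (sval z k) u.
  elim=> {}k {}u _ IH n Mn; apply: contrapT => nxg.
  (* Far enough for [sval z k.+1] to be a child of [sval z k] and for the induction hypothesis to
     apply at level [k.+1]. *)
  pose n' := maxn n (maxn (M k.+1) k.+1).
  have nn' : (n <= n')%N by rewrite leq_maxl.
  have Mn' : (M k.+1 <= n')%N by rewrite !leq_max leqnn orbT.
  have kn' : (k < n')%N by rewrite !leq_max leqnn !orbT.
  have [u1 gu1] := not_rank_gt_child (mono _ _ _ _ _ Mn nn' nxg) (child_z _ _ kn').
  by apply; apply: IH.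
have rk : ranked (x (maxn N (M 0%N))) (sval z 0).
  by apply: contrapT => nrk; apply: (xN _ (leq_maxl N (M 0%N))); apply: not_ranked_range nrk.
by apply: rank_gt_irr (no _ _ _ rk _ (leq_maxr N (M 0%N))).
Qed.

Section Tree.
Variables (lam : nat -> cardinal) (I : Type) (J : nat -> set I).
Variable A : explicit_system lam J.
Hypothesis lam_sl : strong_limit (cardinal_sum lam).
Hypothesis lam_gt_nat : [set: nat] #< [set: cardinal_sum lam].
Hypothesis families : has_small_families A.
Notation L := (cardinal_sum lam).
Notation Gw := (inv_lim (sysG A)).
Notation K t := (range (@sigma_lim _ _ A t)).
Let lam_inc := lam_incr A.

(** Nodes of level [n] are traces of subsets of $\lambda$ on its first [n] summands, so branches
    correspond to the subsets of $\lambda$. *)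
Fixpoint node n : Type := if n is m.+1 then node m * set (lam m) else unit.

Fixpoint prefix (X : set L) n : node n :=
  if n is m.+1 then (prefix X m, [set x | X (existT _ m x)]) else tt.

Lemma small_node n : small lam (node n).
Proof.
elim: n => [|n IH] /=.
  apply: (@small_le _ _ nat); last exact: small_nat.
  by apply: (@card_le_inj _ _ (fun=> 0%N)); case; case.
by apply: small_prod => //; apply: small_set => //; exists n.
Qed.

Lemma prefix_neq X Y : X <> Y ->
  exists N, forall n, (N <= n)%N -> prefix X n <> prefix Y n.
Proof.
move=> XY; have [N XYN] : exists N, prefix X N <> prefix Y N.
  apply: contrapT => nex; apply: XY; apply/seteqP.
  have E n (x : lam n) : X (existT _ n x) = Y (existT _ n x).
    have [_ XYn] : prefix X n.+1 = prefix Y n.+1.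
      by apply: contrapT => ?; apply: nex; exists n.+1.
    by rewrite -[LHS]/([set x | X (existT _ n x)] x) XYn.
  by split=> -[n x]; rewrite E.
exists N => n /subnK <-; elim: (n - N)%N => // j IH [XYj _]; exact: IH.
Qed.

(** Restricting stage [n] to $t\in\mathbf J_n$ and $|H^t_k|\le\lambda_n$ keeps the requirements few;
    every $t$ and $H^t_k$ is reached at some stage. *)
Lemma tree_step n (a : node n -> Gw) : exists f : node n.+1 -> Gw,
  (forall p, lim_proj n (f p) = 1) /\
  forall p q s s' t, p <> q -> J n t ->
    ~ K t (f p * (a s * (a s')^-1) * (f q)^-1) /\
    forall k (h : sysH A t k), [set: sysH A t k] #<= [set: lam n] ->
      ~ rank_gt (f p * (a s * (a s')^-1) * (f q)^-1) (a s * (a s')^-1) h h.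
Proof.
(* [stage] takes one small index type, so elements of the various $H^t_k$ are coded in [lam n];
   groups that are too large get the constant 1. *)
have dec_ex t k : exists d : lam n -> sysH A t k,
    [set: sysH A t k] #<= [set: lam n] -> forall h, exists x, d x = h.
  have [/card_leTP[e eI]|] := pselect ([set: sysH A t k] #<= [set: lam n]); last first.
    by exists (fun=> 1).
  have /choice[d dP] x : exists h, forall h', e h' = x -> h = h'.
    have [[h' h'x]|nex] := pselect (exists h', e h' = x).
      by exists h' => h'' h''x; apply: eI; rewrite h'x h''x.
    by exists 1 => h' h'x; case: nex; exists h'.
  by exists d => _ h; exists (e h); apply: dP.
pose d t k := sval (cid (dec_ex t k)).
have dP t k : [set: sysH A t k] #<= [set: lam n] -> forall h, exists x, d t k x = h.
  by rewrite /d; case: cid.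
have [code codeI] : exists code : {t | J n t} -> lam n, injective code.
  have /card_leP[e] := card_J A n.
  exists (fun t => val (e (SigSub (mem_set (svalP t))))) => t t'.
  by move=> /val_inj/(@inj _ _ _ e); rewrite !inE => /(_ Logic.I Logic.I) [] /sval_inj.
pose X : Type := (node n * node n) * (({t | J n t} * nat) * lam n).
have sX : small lam X.
  do 2![apply: small_prod => //]; try exact: small_node.
    apply: small_prod => //; last exact: small_nat.
    by exists n; apply: card_le_inj codeI.
  by exists n.
have [f fn fP] := stage lam_inc lam_sl lam_gt_nat families n
  (t := fun x : X => sval x.2.1.1) (k := fun x => x.2.1.2)
  (fun x => d _ _ x.2.2) (fun x => a x.1.1 * (a x.1.2)^-1) sX (small_node n.+1).
exists f; split=> // p q s s' t pq Jt; pose t' := exist (J n) t Jt; split.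
  (* The range clause does not involve [h]: level [0] and [code t'], an available element of
     [lam n], merely complete the index. *)
  by have [+ _] := fP p q ((s, s'), ((t', 0%N), code t')) pq.
move=> k h /dP /(_ h)[x <-].
by have [_] := fP p q ((s, s'), ((t', k), x)) pq.
Qed.

Definition tree_factor n (a : node n -> Gw) : node n.+1 -> Gw :=
  sval (cid (tree_step a)).

Fixpoint tree n : node n -> Gw :=
  if n is m.+1 then fun p => tree_factor (@tree m) p * tree p.1 else fun=> 1.
Arguments tree : clear implicits.

Lemma tree_proj m n p : (m <= n)%N ->
  lim_proj m (tree n.+1 p) = lim_proj m (tree n p.1).
Proof.
move=> mn /=; rewrite /tree_factor; case: cid => f [/= fn _].
have fm : lim_proj m (f p) = 1.
  by rewrite /lim_proj -(svalP (f p) _ _ mn) [X in proj _ _ X]fn gmulf1.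
by rewrite -[LHS]/(lim_proj m (f p) * lim_proj m (tree n p.1)) fm mul1g.
Qed.

Lemma tree_prefix_proj X k n : (k <= n)%N ->
  lim_proj k (tree n (prefix X n)) = lim_proj k (tree k (prefix X k)).
Proof.
move=> /subnK <-; elim: (n - k)%N => // j IH.
by rewrite tree_proj ?leq_addl.
Qed.

Definition branch (X : set L) : Gw.
Proof.
exists (fun m => lim_proj m (tree m (prefix X m))) => m n mn.
by rewrite -(tree_prefix_proj X mn); apply: (svalP (tree n (prefix X n))).
Defined.

Lemma branch_neq X Y t : X <> Y -> ~ Defs.eqE t (branch X) (branch Y).
Proof.
move=> /prefix_neq[N XYN].
pose x n := tree n (prefix X n) * (tree n (prefix Y n))^-1.
have [N1 Jt] : exists N1, forall n, (N1 <= n)%N -> J n t.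
  have [N1 _ JN1] : (\bigcup_n J n) t by rewrite (J_cover A).
  by exists N1 => n /(J_incr A); apply.
apply: (@range_descent _ _ _ _ x).
- move=> k n kn; rewrite /x -[LHS]/(lim_proj k (tree n (prefix X n)) *
    (lim_proj k (tree n (prefix Y n)))^-1) !tree_prefix_proj //.
- exists (maxn N N1).+1 => -[//|n]; rewrite ltnS geq_max => /andP[Nn N1n].
  rewrite /x /= /tree_factor; case: cid => f [/= _ fP].
  have [+ _] := fP (prefix X n.+1) (prefix Y n.+1) (prefix X n) (prefix Y n) t
    (XYN _ (leqW Nn)) (Jt _ N1n).
  by rewrite !gnorm.
- move=> k; have [M HM] : small lam (sysH A t k) by apply: lt_small => //; exact: card_Hlt.
  exists (maxn M (maxn N N1)) => n; rewrite !geq_max => /and3P[Mn Nn N1n] h.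
  rewrite /x /= /tree_factor; case: cid => f [/= _ fP].
  have [_ /(_ k h)] := fP (prefix X n.+1) (prefix Y n.+1) (prefix X n) (prefix Y n) t
    (XYN _ (leqW Nn)) (Jt _ N1n).
  by rewrite !gnorm; apply; apply: card_le_trans HM (lam_le lam_inc Mn).
Qed.

End Tree.

(** * Lower and upper bounds for $\operatorname{nu}$ *)

Lemma nu_small_families (lam : nat -> cardinal) (I : Type) (J : nat -> set I)
    (A : explicit_system lam J)
    (lam_sl : strong_limit (cardinal_sum lam))
    (lam_gt_nat : [set: nat] #< [set: cardinal_sum lam]) (N : cardinal) :
  is_nu A N -> [set: cardinal_sum lam] #<= [set: N] -> has_small_families A.
Proof.
have lam_inc := lam_incr A.
move=> [_ Nmin] LN m T [n /card_leTP[e eI]].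
(* Otherwise $\lambda_n$ would bound all candidates, giving
   $\lambda\le\operatorname{nu}\le\lambda_n$. *)
have [mu mu_cand mu_big] : exists2 mu, nu_candidate A mu &
    ~ ([set: mu] #<= [set: lam n]).
  apply: contrapT => nex; apply: (sum_not_small lam_inc); exists n.
  apply: card_le_trans LN _; apply: Nmin => mu mu_cand.
  by apply: contrapT => ?; apply: nex; exists mu.
have [f [f_proj fE]] := mu_cand m.
have [s sI sE] : exists2 s : lam n -> mu, injective s &
    forall u v, lim_proj m (f (s u)) = lim_proj m (f (s v)).
  have [muL|muL] := pselect ([set: mu] #<= [set: cardinal_sum lam]).
    have [//|/card_leTP[s sI]] := card_le_total mu (lam n).
    by exists s => // u v; apply: f_proj.
  (* For [mu] not below $\lambda$ the projections are arbitrary, but they take few values in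
     $G_m$. *)
  have [|c [s sI sc]] := @card_pigeonhole mu (sysG A m) (lam n) (fun i => lim_proj m (f i)).
    move=> mu_small; apply: muL; apply: card_le_trans mu_small _.
    have [k le_k] : small lam (sysG A m * lam n).
      apply: small_prod => //; last by exists n.
      by exists m; apply: card_Gn.
    exact: card_le_trans le_k (lam_le_sum _ _).
  by exists s => // u v; rewrite !sc.
have [[a0]|nT] := pselect (inhabited T); last first.
  by exists (fun=> 1) => [a|a]; case: nT.
(* Right translation by one member makes the projections trivial and preserves the quotients. *)
exists (fun a => f (s (e a)) * (f (s (e a0)))^-1) => [a|a b t ab].
  by rewrite -[LHS]/(lim_proj m (f (s (e a))) * (lim_proj m (f (s (e a0))))^-1)
    (sE (e a) (e a0)) mulgV.
rewrite /Defs.eqE invgM invgK mulgA mulgVK; apply: fE.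
by move=> /sI/eI.
Qed.

Lemma card_inv_lim (lam : nat -> cardinal) (S : inv_system) :
  (forall n, [set: S n] #<= [set: lam n]) ->
  [set: inv_lim S] #<= [set: set (cardinal_sum lam)].
Proof.
move=> Slam; pose e n := sval (cid ((card_leTP _ _).1 (Slam n))).
have eI n : injective (e n) by rewrite /e; case: cid.
apply: (@card_le_inj _ _ (fun f => [set p | projT2 p = e (projT1 p) (sval f (projT1 p))])).
move=> f g fg; apply: inv_limP => n; apply: eI.
suff : [set p : cardinal_sum lam | projT2 p = e (projT1 p) (sval g (projT1 p))]
  (existT _ n (e n (sval f n))) by [].
by rewrite -fg.
Qed.

Lemma candidate_le_inv_lim (L : cardinal) (I : Type) (A : system L I) (t : I)
  (mu : cardinal) : nu_candidate A mu -> [set: mu] #<= [set: inv_lim (sysG A)].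
Proof.
move=> /(_ 0%N)[f [_ fE]]; apply: (@card_le_inj _ _ f) => i j fij.
apply: contrapT => /fE -/(_ t); apply; rewrite /Defs.eqE fij mulgV.
by exists 1 => //; apply: inv_limP => n /=; apply: gmulf1.
Qed.

Theorem theorem5p9 (lam : nat -> cardinal) (I : Type) (J : nat -> set I)
    (A : explicit_system lam J)
    (lam_strong_limit : strong_limit (cardinal_sum lam))
    (lam_cf : has_cofinality (cardinal_sum lam) nat)
    (lam_gt_cf : [set: nat] #< [set: cardinal_sum lam])
    (N : cardinal) (nuN : is_nu A N)
    (nu_ge_lam : [set: cardinal_sum lam] #<= [set: N]) :
  [set: N] #= [set: cardinal_pow2 (cardinal_sum lam)] /\ nu_candidate A N.
Proof.
set L := cardinal_sum lam in lam_strong_limit lam_gt_cf nu_ge_lam *.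
have families := nu_small_families lam_strong_limit lam_gt_cf nuN nu_ge_lam.
pose b := branch lam_strong_limit lam_gt_cf families.
(* Above $\lambda$ the condition on projections is vacuous. *)
have pow_cand (mu : cardinal) (e : mu -> set L) : injective e ->
    ~ ([set: mu] #<= [set: L]) -> nu_candidate A mu.
  move=> eI muL n; exists (fun i => b (e i)); split=> // i j t ij.
  by apply: branch_neq => /eI.
have pow_le_N : [set: set L] #<= [set: N].
  by apply: nuN.1; apply: (pow_cand _ id) => //; apply: cantor.
have [[t]|nI] := pselect (inhabited I); last first.
  (* For empty [I] every cardinal is a candidate, even the power set of [N]. *)
  have : [set: set N] #<= [set: N].
    apply: nuN.1 => n; exists (fun=> 1); split=> // i j t; case: nI; exact: inhabits.
  by move/cantor.
have N_le_pow : [set: N] #<= [set: set L].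
  apply: nuN.2 => mu /(candidate_le_inv_lim t) mu_le.
  exact: card_le_trans mu_le (card_inv_lim (card_Gn A)).
split; first by rewrite card_eq_le N_le_pow pow_le_N.
have /card_leTP[e eI] := N_le_pow.
(* As [N] embeds in the power set of $\lambda$ and exceeds $\lambda$, it is itself a candidate, so
   the supremum is attained. *)
apply: pow_cand eI _ => NL; apply: (@cantor L); exact: card_le_trans pow_le_N NL.
Qed.
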